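(* Let $G$ be a connected regular graph with at least two vertices, let $a\in V(G)$, and let $D=\operatorname{ecc}(a)$. Then $$e\mathcal T(a)e=\langle B,E_1^*|_e,\ldots,E_D^*|_e,bb^{\mathsf T}\rangle .$$ If $G-a$ is connected, then $bb^{\mathsf T}\in\mathcal B_a$ and hence $$e\mathcal T(a)e=\langle\mathcal B_a,E_2^*|_e,\ldots,E_D^*|_e\rangle .$$ In this case ($G-a$ connected), $e\mathcal T(a)e=\mathcal B_a$ holds if and only if all residual distance projections $E_1^*|_e,\ldots,E_D^*|_e$ belong to $\mathcal B_a$.
   Context: All graphs are finite and simple; all algebras are over $\mathbb R$; $\langle\cdots\rangle$ denotes the real unital algebra generated. $A$ is the adjacency matrix of $G$. $E_i^*$ is the diagonal projection of $\mathbb R^{V(G)}$ onto the vertices at distance $i$ from $a$, $0\le i\le D$, with $D=\operatorname{ecc}(a)$ the maximum distance from $a$. The Terwilliger (subconstituent) algebra is $\mathcal T(a)=\langle A,E_0^*,\ldots,E_D^*\rangle$. Put $e=I-E_0^*$; the corner $e\mathcal T(a)e$ is identified with an algebra of operators on the residual space $e\mathbb R^{V(G)}=\mathbb R^{V(G)\setminus\{a\}}$, and $E_i^*|_e$ is the restriction of $E_i^*$ to this space. $B=A(G-a)$ is the adjacency matrix of the vertex-deleted graph, $b=\mathbf 1_{N(a)}\in\mathbb R^{V(G)\setminus\{a\}}$ is the indicator vector of the neighbourhood of $a$, $E$ is the diagonal matrix with diagonal $\mathbf 1_{N(a)}$ (so $E=E_1^*|_e$), and $\mathcal B_a=\langle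 I,B,E\rangle$. *)

(* Defs.v *)
From HB Require Import structures.
From mathcomp Require Import all_boot all_order all_algebra.
From mathcomp Require Import boolp classical_sets reals.

Set Implicit Arguments.
Unset Strict Implicit.
Unset Printing Implicit Defensive.

Import Order.TTheory GRing.Theory Num.Theory.

Local Open Scope classical_set_scope.
Local Open Scope ring_scope.

Section Graph.
Variables (V : finType) (adj : rel V).

Definition simple_graph : Prop := symmetric adj /\ irreflexive adj.

Definition connected_graph : Prop := forall x y : V, connect adj x y.

Definition regular_graph : Prop := exists k : nat, forall v : V, #|adj v| = k.

Definition walk (x y : V) (k : nat) : bool :=
  [exists p : k.-tuple V, path adj x p && (last x p == y)].

(* The least length of a walk from x to y.  A shortest walk has fewer than
   #|V| edges, so the search is exhaustive; the value is #|V| when y is not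
   reachable from x. *)
Definition dist (x y : V) : nat := find (walk x y) (iota 0 #|V|).

Definition ecc (a : V) : nat := \max_(v : V) dist a v.

Definition residual (a : V) : finType := {v : V | v != a}.

Definition delete_vertex (a : V) : rel (residual a) :=
  fun u w => adj (val u) (val w).

End Graph.

Arguments delete_vertex {V} adj a _ _.

Section Algebra.
Variable R : realType.

Definition unital_subalgebra (n : nat) (S : set 'M[R]_n) : Prop :=
  [/\ S 1%:M,
      forall M N, S M -> S N -> S (M + N),
      forall (c : R) M, S M -> S (c *: M) &
      forall M N, S M -> S N -> S (M *m N)].

Definition alg_gen (n : nat) (X : set 'M[R]_n) : set 'M[R]_n :=
  smallest (@unital_subalgebra n) X.

(* Operators on R^V are matrices indexed by 'I_#|V|, through the enumeration
   of V. *)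
Definition adjmx (V : finType) (adj : rel V) : 'M[R]_#|V| :=
  \matrix_(i, j) (adj (enum_val i) (enum_val j))%:R.

Section Terwilliger.
Variables (V : finType) (adj : rel V) (a : V).

Definition Estar (i : nat) : 'M[R]_#|V| :=
  diag_mx (\row_j (dist adj a (enum_val j) == i)%:R).

Definition terwilliger : set 'M[R]_#|V| :=
  alg_gen (adjmx adj |` [set Estar i | i in [set i | (i <= ecc adj a)%N]]).

(* The index in 'I_#|V| of a vertex of V \ {a}. *)
Definition residual_index (i : 'I_#|residual a|) : 'I_#|V| :=
  enum_rank (val (enum_val i)).

(* The block of M on V \ {a}: for an M that preserves the space of vectors
   vanishing at a, this is the matrix of the restriction of M to it. *)
Definition restrict (M : 'M[R]_#|V|) : 'M[R]_#|residual a| :=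
  mxsub residual_index residual_index M.

Definition corner_proj : 'M[R]_#|V| := 1%:M - Estar 0.

Definition corner_algebra : set 'M[R]_#|residual a| :=
  [set restrict (corner_proj *m M *m corner_proj) | M in terwilliger].

Definition EstarR (i : nat) : 'M[R]_#|residual a| := restrict (Estar i).

Definition Bmx : 'M[R]_#|residual a| := adjmx (delete_vertex adj a).

Definition bvec : 'cV[R]_#|residual a| :=
  \col_i (adj a (val (enum_val i)))%:R.

Definition Emx : 'M[R]_#|residual a| := diag_mx bvec^T.

Definition Balg : set 'M[R]_#|residual a| :=
  alg_gen [set 1%:M; Bmx; Emx].

End Terwilliger.
End Algebra.

Arguments Estar R {V} adj a i.
Arguments terwilliger R {V} adj a _.
Arguments corner_algebra R {V} adj a _.
Arguments EstarR R {V} adj a i.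
Arguments Bmx R {V} adj a.
Arguments bvec R {V} adj a.
Arguments Emx R {V} adj a.
Arguments Balg R {V} adj a _.

(* Main.v *)
Require Import Defs.
From HB Require Import structures.
From mathcomp Require Import all_boot all_order all_algebra.
From mathcomp Require Import boolp classical_sets reals.

Import Order.TTheory GRing.Theory Num.Theory.

Local Open Scope classical_set_scope.
Local Open Scope ring_scope.

(** Write an operator on [R^V] in block form along [V = {a} + (V \ {a})].  The
    adjacency matrix is [(0, b^T; b, B)] and the projections are block diagonal.
    In a product of such matrices the residual block picks up, besides products
    of residual blocks, a product of the form column times row, that is
    [X b b^T Y].  Hence the matrices whose residual block lies in an algebra
    [C] containing [b b^T], and whose off-diagonal blocks lie in [C b] and
    [b^T C], form an algebra ([block_subalgebra]).  Taking for [C] the algebra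
    generated by [B], the [E_i^*] and [b b^T] bounds the corner from above.
    Conversely each of these generators is a residual block of an element of the
    Terwilliger algebra, [b b^T] being that of [A E_0^* A] ([corner_bvec]), and
    the corner is an algebra ([corner_subalgebra]).

    When [G - a] is connected, [b b^T] is expressed through [B] and [E] by means
    of the all-ones matrix [J]: since [E] applied to the all-ones vector is [b],
    one has [b b^T = E J E].  As [G] is [k]-regular, the nonnegative symmetric
    matrix [B + E] has constant row sums [k].  By the maximum principle
    ([harmonic_constant]) connectedness makes [k] a simple eigenvalue of it, and
    then [J] is a polynomial in [B + E] ([ones_mem_subalgebra]), in the manner of
    Hoffman's theorem on the adjacency matrix of a connected regular graph.  Thus
    [b b^T] lies in [<I, B, E>] ([bvec_Balg]).  Because [E = E_1^*], the remaining
    claims are comparisons of generating sets. *)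

(** * Generated algebras *)

Lemma alg_gen_subalgebra (R : realType) (n : nat) (X : set 'M[R]_n) :
  unital_subalgebra (alg_gen X).
Proof.
split=> [S [[S1 _ _ _] _] //|M N hM hN S hS|c M hM S hS|M N hM hN S hS];
  have [[_ SD SZ SM] _] := hS.
- by apply: SD; [apply: hM | apply: hN].
- by apply: SZ; apply: hM.
- by apply: SM; [apply: hM | apply: hN].
Qed.

Lemma horner_mx_subalgebra (R : realType) (n : nat) (S : set 'M[R]_n.+1)
    (M : 'M[R]_n.+1) (p : {poly R}) :
  unital_subalgebra S -> S M -> S (horner_mx M p).
Proof.
move=> [S1 SD SZ SM] hM; elim/poly_ind: p => [|p c IHp].
  by rewrite rmorph0 -(scale0r 1%:M); apply: SZ.
rewrite rmorphD rmorphM /= horner_mx_X horner_mx_C -scalemx1.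
by apply: SD; [apply: SM | apply: SZ].
Qed.

(** * The all-ones matrix as a polynomial *)

(** The minimal polynomial of [M] factors as [q * ('X - k)] since the
    all-ones vector is an eigenvector.  By the symmetry of [M] all rows and
    columns of [q(M)] lie in the eigenspace of [k], so [q(M)] is a constant matrix; it is nonzero
    because [q] is a proper divisor of the minimal polynomial. *)
Lemma ones_mem_subalgebra (R : realType) (n : nat) (S : set 'M[R]_n)
    (M : 'M[R]_n) (k : R) :
  unital_subalgebra S -> S M -> M^T = M ->
  M *m const_mx 1 = k *: (const_mx 1 : 'cV_n) ->
  (forall x : 'cV[R]_n, M *m x = k *: x -> forall i j, x i 0 = x j 0) ->
  S (const_mx 1).
Proof.
(* Evaluation of polynomials needs a ring of matrices of positive size; in size
   zero the all-ones matrix is the identity. *)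
case: n S M => [|n] S M hS SM Msym Mone kerM.
  by case: hS => S1 _ _ _; rewrite (thinmx0 (const_mx 1)) -(thinmx0 1%:M).
have : root (mxminpoly M) k.
  rewrite -eigenvalue_root_min; apply/eigenvalueP.
  exists (const_mx 1); last first.
    by apply/eqP => /rowP/(_ 0)/eqP; rewrite !mxE oner_eq0.
  by apply: trmx_inj; rewrite trmx_mul Msym trmx_const Mone linearZ /= trmx_const.
case/factor_theorem=> q defq; set P := horner_mx M q.
have PM : P *m M = k *: P.
  apply/eqP; rewrite -subr_eq0 -mul_mx_scalar -mulmxBr; apply/eqP.
  have := mx_root_minpoly M.
  by rewrite defq rmorphM rmorphB /= horner_mx_X horner_mx_C.
have MP : M *m P = k *: P.
  by rewrite -PM; apply/esym; apply: comm_horner_mx.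
have Pcol i i' j : P i j = P i' j.
  have := kerM (col j P); rewrite !colE mulmxA MP scalemxAl -colE.
  by move/(_ erefl i i'); rewrite !mxE.
have Prow i j j' : P i j = P i j'.
  have := kerM (row i P)^T; rewrite -{1}Msym -trmx_mul rowE -mulmxA PM -scalemxAr.
  by rewrite linearZ -rowE => /(_ erefl j j'); rewrite !mxE.
have PE : P = P 0 0 *: const_mx 1.
  by apply/matrixP=> i j; rewrite (Pcol i 0) (Prow 0 j 0) !mxE mulr1.
have P00 : P 0 0 != 0.
  apply/eqP=> P0; have /mxminpoly_min : P = 0 by rewrite PE P0 scale0r.
  have q0 : q != 0.
    apply/eqP => q0; have := monic_neq0 (mxminpoly_monic M).
    by rewrite defq q0 mul0r eqxx.
  move/(dvdp_leq q0); rewrite defq size_Mmonic ?monicXsubC //.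
  by rewrite size_XsubC addn2 ltnn.
have -> : const_mx 1 = (P 0 0)^-1 *: P.
  by rewrite PE !mxE mulr1 scalerA mulVf ?scale1r.
by have [_ _ SZ _] := hS; apply: SZ; apply: horner_mx_subalgebra.
Qed.

(** The maximum principle: at a vertex where [x] is largest all terms of the
    vanishing sum are nonnegative, so the neighbours carry the largest value
    too. *)
Lemma harmonic_constant {R : realType} {W : finType} {e : rel W} {x : W -> R} :
  connected_graph e ->
  (forall u, \sum_w (e u w)%:R * (x u - x w) = 0) -> forall u w, x u = x w.
Proof.
move=> econn xharm u0.
have [m _ maxm] := @arg_maxP _ _ W u0 xpredT x isT.
have xm u : x u = x m.
  have /connectP[p mp ->] := econn m u.
  elim/last_ind: p mp => [//|p w IHp].
  rewrite rcons_path last_rcons => /andP[/IHp xl lw].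
  have ge0 v : true -> 0 <= (e (last m p) v)%:R * (x (last m p) - x v).
    by move=> _; rewrite mulr_ge0 ?ler0n // subr_ge0 xl; apply: maxm.
  have := psumr_eq0P ge0 (xharm (last m p)) (i := w) isT.
  by rewrite lw mul1r => /eqP; rewrite subr_eq0 xl eq_sym => /eqP.
by move=> w; rewrite !xm.
Qed.

(** * Block decomposition at the base vertex *)

Section Blocks.
Context {R : realType} {V : finType} (a : V).

Definition base_col (M : 'M[R]_#|V|) : 'cV[R]_#|residual a| :=
  \col_i M (residual_index i) (enum_rank a).

Definition base_row (M : 'M[R]_#|V|) : 'rV[R]_#|residual a| :=
  \row_j M (enum_rank a) (residual_index j).

Lemma sum_residual (F : V -> R) :
  \sum_v F v = F a + \sum_(w : residual a) F (val w).
Proof. by rewrite (bigD1 a) //= (big_sub [pred v | v != a]). Qed.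

Lemma sum_residual_index (F : 'I_#|V| -> R) :
  \sum_j F j = F (enum_rank a) + \sum_(i : 'I_#|residual a|) F (residual_index i).
Proof.
rewrite (reindex _ (onW_bij _ (@enum_rank_bij V))) sum_residual; congr (_ + _).
by rewrite (reindex _ (onW_bij _ (@enum_val_bij (residual a)))).
Qed.

Lemma residual_index_eq (i j : 'I_#|residual a|) :
  (residual_index i == residual_index j) = (i == j).
Proof.
by rewrite (inj_eq enum_rank_inj) (inj_eq val_inj) (inj_eq enum_val_inj).
Qed.

Lemma enum_val_residual_index (i : 'I_#|residual a|) :
  enum_val (residual_index i) = val (enum_val i).
Proof. exact: enum_rankK. Qed.

Lemma residual_index_neq (i : 'I_#|residual a|) :
  (residual_index i == enum_rank a) = false.
Proof.
by rewrite (inj_eq enum_rank_inj); apply/negbTE; exact: (valP (enum_val i)).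
Qed.

Lemma restrictM (M N : 'M[R]_#|V|) :
  restrict a (M *m N) =
  restrict a M *m restrict a N + base_col M *m base_row N.
Proof.
apply/matrixP=> i j; rewrite !mxE sum_residual_index addrC big_ord1 !mxE.
by congr (_ + _); apply: eq_bigr => l _; rewrite !mxE.
Qed.

Lemma base_colM (M N : 'M[R]_#|V|) :
  base_col (M *m N) =
  restrict a M *m base_col N + N (enum_rank a) (enum_rank a) *: base_col M.
Proof.
apply/colP=> i; rewrite !mxE sum_residual_index addrC mulrC.
by congr (_ + _); apply: eq_bigr => l _; rewrite !mxE.
Qed.

Lemma base_rowM (M N : 'M[R]_#|V|) :
  base_row (M *m N) =
  base_row M *m restrict a N + M (enum_rank a) (enum_rank a) *: base_row N.
Proof.
apply/rowP=> i; rewrite !mxE sum_residual_index addrC.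
by congr (_ + _); apply: eq_bigr => l _; rewrite !mxE.
Qed.

Lemma restrict1 : restrict a (1%:M : 'M[R]_#|V|) = 1%:M.
Proof. by apply/matrixP=> i j; rewrite !mxE residual_index_eq. Qed.

Lemma base_col_diag (d : 'rV[R]_#|V|) : base_col (diag_mx d) = 0.
Proof. by apply/colP=> i; rewrite !mxE residual_index_neq. Qed.

Lemma base_row_diag (d : 'rV[R]_#|V|) : base_row (diag_mx d) = 0.
Proof. by apply/rowP=> i; rewrite !mxE eq_sym residual_index_neq. Qed.

(** Since [C] contains [b b^T], the products of off-diagonal blocks
    [X b] and [b^T Y] of such matrices fall back into [C], so the block
    conditions survive matrix multiplication. *)
Lemma block_subalgebra (C : set 'M[R]_#|residual a|)
    (b : 'cV[R]_#|residual a|) :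
  unital_subalgebra C -> C (b *m b^T) ->
  unital_subalgebra
    [set M : 'M[R]_#|V| | [/\ C (restrict a M),
       exists2 X, C X & base_col M = X *m b &
       exists2 Y, C Y & base_row M = b^T *m Y]].
Proof.
move=> [C1 CD CZ CM] Cbb.
have C0 : C 0 by rewrite -(scale0r 1%:M); apply: CZ.
split=> /=.
- rewrite restrict1; split=> //; exists 0 => //.
    by rewrite -diag_const_mx base_col_diag mul0mx.
  by rewrite -diag_const_mx base_row_diag mulmx0.
- move=> M N [MC [X CX MX] [Y CY MY]] [NC [X' CX' NX] [Y' CY' NY]]; split.
  + have -> : restrict a (M + N) = restrict a M + restrict a N.
      by apply/matrixP=> i j; rewrite !mxE.
    exact: CD.
  + exists (X + X'); first exact: CD.
    by rewrite mulmxDl -MX -NX; apply/colP=> i; rewrite !mxE.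
  + exists (Y + Y'); first exact: CD.
    by rewrite mulmxDr -MY -NY; apply/rowP=> i; rewrite !mxE.
- move=> c M [MC [X CX MX] [Y CY MY]]; split.
  + have -> : restrict a (c *: M) = c *: restrict a M.
      by apply/matrixP=> i j; rewrite !mxE.
    exact: CZ.
  + exists (c *: X); first exact: CZ.
    by rewrite -scalemxAl -MX; apply/colP=> i; rewrite !mxE.
  + exists (c *: Y); first exact: CZ.
    by rewrite -scalemxAr -MY; apply/rowP=> i; rewrite !mxE.
- move=> M N [MC [X CX MX] [Y CY MY]] [NC [X' CX' NX] [Y' CY' NY]]; split.
  + rewrite restrictM MX NY mulmxA -(mulmxA X) -mulmxA; apply: CD; first exact: CM.
    by rewrite mulmxA; apply: (CM _ _ _ CY'); apply: CM.
  + exists (restrict a M *m X' + N (enum_rank a) (enum_rank a) *: X).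
      by apply: CD; [apply: CM | apply: CZ].
    by rewrite base_colM NX MX mulmxDl mulmxA scalemxAl.
  + exists (Y *m restrict a N + M (enum_rank a) (enum_rank a) *: Y').
      by apply: CD; [apply: CM | apply: CZ].
    by rewrite base_rowM NY MY mulmxDr mulmxA scalemxAr.
Qed.

End Blocks.

(** * Distance projections *)

Section Distance.
Context {V : finType} (adj : rel V).

Lemma walk0 (x y : V) : walk adj x y 0 = (x == y).
Proof.
apply/existsP/eqP=> [[p]|->]; last by exists [tuple]; rewrite /= eqxx.
by rewrite tuple0 => /eqP.
Qed.

Lemma walk1 (x y : V) : walk adj x y 1 = adj x y.
Proof.
apply/existsP/idP=> [[p]|xy]; last by exists [tuple y]; rewrite /= xy eqxx.
by case/tupleP: p => z p; rewrite tuple0 /= andbT => /andP[? /eqP <-].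
Qed.

Lemma dist_eq0 (x y : V) : (dist adj x y == 0%N) = (x == y).
Proof.
have : (0 < #|V|)%N by apply/card_gt0P; exists x.
by rewrite /dist; case: #|V| => [//|n] _ /=; rewrite walk0; case: (x == y).
Qed.

Lemma dist_eq1 (x y : V) : y != x -> (dist adj x y == 1%N) = adj x y.
Proof.
move=> yx.
have : (1 < #|V|)%N.
  by rewrite -cardsT (cardD1 x) (cardD1 y) !inE yx.
rewrite /dist; case: #|V| => [|[|n]] // _ /=.
by rewrite walk0 walk1 (eq_sym x) (negbTE yx); case: (adj x y).
Qed.

Lemma ecc_gt0 (a : V) : (2 <= #|V|)%N -> (1 <= ecc adj a)%N.
Proof.
move=> V2; have [v va] : exists v, v != a.
  have : (0 < #|predC1 a|)%N by rewrite cardC1 -ltnS prednK // ltnW.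
  by case/card_gt0P=> v; exists v.
apply: leq_trans (leq_bigmax v).
by rewrite lt0n dist_eq0 eq_sym.
Qed.

End Distance.

Section Corner.
Context {R : realType} {V : finType} (adj : rel V) (a : V).

Lemma base_col_Estar (i : nat) : base_col a (Estar R adj a i) = 0.
Proof. exact: base_col_diag. Qed.

Lemma base_row_Estar (i : nat) : base_row a (Estar R adj a i) = 0.
Proof. exact: base_row_diag. Qed.

Lemma Estar_base (i : nat) :
  Estar R adj a i (enum_rank a) (enum_rank a) = (i == 0%N)%:R.
Proof.
have /eqP d0 : dist adj a a == 0%N by rewrite dist_eq0.
by rewrite !mxE eqxx enum_rankK d0 eq_sym mulr1n.
Qed.

Lemma EstarR0 : EstarR R adj a 0 = 0.
Proof.
apply/matrixP=> i j; rewrite !mxE enum_val_residual_index dist_eq0 (eq_sym a).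
by rewrite (negbTE (valP (enum_val i))) mul0rn.
Qed.

Lemma EstarR1 : EstarR R adj a 1 = Emx R adj a.
Proof.
apply/matrixP=> i j; rewrite !mxE enum_val_residual_index residual_index_eq.
by rewrite dist_eq1 // (valP (enum_val i)).
Qed.

Lemma restrict_corner_proj : restrict a (corner_proj R adj a) = 1%:M.
Proof.
have -> : restrict a (corner_proj R adj a) =
    restrict a 1%:M - EstarR R adj a 0 by apply/matrixP=> i j; rewrite !mxE.
by rewrite restrict1 EstarR0 subr0.
Qed.

Lemma base_col_mul_corner (M : 'M[R]_#|V|) :
  base_col a (M *m corner_proj R adj a) = 0.
Proof.
have e_base : corner_proj R adj a (enum_rank a) (enum_rank a) = 0.
  by rewrite mxE [X in _ + X]mxE Estar_base mxE !eqxx subrr.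
have e_col : base_col a (corner_proj R adj a) = 0.
  by rewrite /corner_proj -diag_const_mx -raddfB base_col_diag.
by rewrite base_colM e_base e_col mulmx0 scale0r addr0.
Qed.

Lemma restrict_mul_corner (M : 'M[R]_#|V|) :
  restrict a (M *m corner_proj R adj a) = restrict a M.
Proof.
have e_row : base_row a (corner_proj R adj a) = 0.
  by rewrite /corner_proj -diag_const_mx -raddfB base_row_diag.
by rewrite restrictM e_row mulmx0 addr0 restrict_corner_proj mulmx1.
Qed.

(** The projection removes the column at [a], hence the contribution of [a] to
    the product: this makes the corner closed under multiplication. *)
Lemma restrict_corner_mul (M N : 'M[R]_#|V|) :
  restrict a (M *m corner_proj R adj a *m N) = restrict a M *m restrict a N.
Proof.
by rewrite restrictM base_col_mul_corner mul0mx addr0 restrict_mul_corner.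
Qed.

Lemma restrict_corner (M : 'M[R]_#|V|) :
  restrict a (corner_proj R adj a *m M *m corner_proj R adj a) = restrict a M.
Proof.
rewrite restrict_mul_corner -[X in X *m M]mul1mx restrict_corner_mul.
by rewrite restrict1 mul1mx.
Qed.

Lemma corner_algebraE :
  corner_algebra R adj a = [set restrict a M | M in terwilliger R adj a].
Proof.
by apply/seteqP; split=> _ [M hM <-]; exists M; rewrite ?restrict_corner.
Qed.

Lemma restrict_adjmx : restrict a (adjmx R adj) = Bmx R adj a.
Proof. by apply/matrixP=> i j; rewrite !mxE !enum_val_residual_index. Qed.

Lemma base_row_adjmx : base_row a (adjmx R adj) = (bvec R adj a)^T.
Proof.
by apply/rowP=> i; rewrite !mxE enum_val_residual_index enum_rankK.
Qed.

Lemma base_col_adjmx :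
  symmetric adj -> base_col a (adjmx R adj) = bvec R adj a.
Proof.
move=> sym; apply/colP=> i.
by rewrite !mxE enum_val_residual_index enum_rankK sym.
Qed.

End Corner.

(** * The corner of the Terwilliger algebra *)

Section CornerAlgebra.
Context {R : realType} {V : finType} (adj : rel V) (a : V).

Lemma terwilliger_Estar (i : nat) :
  (i <= ecc adj a)%N -> terwilliger R adj a (Estar R adj a i).
Proof. by move=> hi; apply: sub_gen_smallest; right; exists i. Qed.

Lemma terwilliger_adjmx : terwilliger R adj a (adjmx R adj).
Proof. by apply: sub_gen_smallest; left. Qed.

Lemma corner_subalgebra : unital_subalgebra (corner_algebra R adj a).
Proof.
have [T1 TD TZ TM] : unital_subalgebra (terwilliger R adj a).
  exact: alg_gen_subalgebra.
have Te : terwilliger R adj a (corner_proj R adj a).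
  rewrite /corner_proj -scaleN1r; apply: TD => //; apply: TZ.
  exact: terwilliger_Estar.
rewrite corner_algebraE; split.
- by exists 1%:M => //; apply: restrict1.
- move=> _ _ [M hM <-] [N hN <-].
  by exists (M + N); [apply: TD | apply/matrixP=> i j; rewrite !mxE].
- move=> c _ [M hM <-].
  by exists (c *: M); [apply: TZ | apply/matrixP=> i j; rewrite !mxE].
- move=> _ _ [M hM <-] [N hN <-].
  (* Without the projection in the middle the residual block of the product
     would contain the terms that pass through the base vertex. *)
  exists (M *m corner_proj R adj a *m N); last exact: restrict_corner_mul.
  by apply: (TM _ _ _ hN); apply: TM.
Qed.

Lemma corner_Bmx : corner_algebra R adj a (Bmx R adj a).
Proof.
rewrite corner_algebraE; exists (adjmx R adj); last exact: restrict_adjmx.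
exact: terwilliger_adjmx.
Qed.

Lemma corner_EstarR (i : nat) :
  (i <= ecc adj a)%N -> corner_algebra R adj a (EstarR R adj a i).
Proof.
rewrite corner_algebraE => hi.
by exists (Estar R adj a i) => //; apply: terwilliger_Estar.
Qed.

(** [b b^T] is the residual block of [A E_0^* A], which counts the walks of
    length two through the base vertex. *)
Lemma corner_bvec : symmetric adj ->
  corner_algebra R adj a (bvec R adj a *m (bvec R adj a)^T).
Proof.
move=> sym; have [_ _ _ TM] : unital_subalgebra (terwilliger R adj a).
  exact: alg_gen_subalgebra.
rewrite corner_algebraE.
exists (adjmx R adj *m Estar R adj a 0 *m adjmx R adj).
  apply: (TM _ _ _ terwilliger_adjmx); apply: (TM _ _ terwilliger_adjmx).
  exact: terwilliger_Estar.
rewrite restrictM base_row_adjmx base_colM base_col_Estar mulmx0 add0r.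
rewrite Estar_base scale1r base_col_adjmx // restrictM base_row_Estar mulmx0.
by rewrite addr0 [restrict a (Estar R adj a 0)]EstarR0 mulmx0 mul0mx add0r.
Qed.

Lemma corner_algebra_gen : symmetric adj ->
  corner_algebra R adj a =
    alg_gen (Bmx R adj a |`
      ([set EstarR R adj a i | i in [set i | (1 <= i <= ecc adj a)%N]] `|`
       [set bvec R adj a *m (bvec R adj a)^T])).
Proof.
move=> sym; set C := alg_gen _; apply/seteqP; split.
- have Calg : unital_subalgebra C by apply: alg_gen_subalgebra.
  have [C1 _ CZ _] := Calg.
  have C0 : C 0 by rewrite -(scale0r 1%:M); apply: CZ.
  have Cbb : C (bvec R adj a *m (bvec R adj a)^T).
    by apply: sub_gen_smallest; right; right.
  rewrite corner_algebraE => _ [M hM <-].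
  suff [] : [/\ C (restrict a M),
      exists2 X, C X & base_col a M = X *m bvec R adj a &
      exists2 Y, C Y & base_row a M = (bvec R adj a)^T *m Y] by [].
  move: M hM; apply: (smallest_sub (block_subalgebra _ _ _ Calg Cbb)).
  move=> _ [->|[i hi <-]] /=; split.
  + by rewrite restrict_adjmx; apply: sub_gen_smallest; left.
  + by exists 1%:M; rewrite // mul1mx base_col_adjmx.
  + by exists 1%:M; rewrite // mulmx1 base_row_adjmx.
  (* [E_0^*] is not among the generators of [C], but vanishes off [a]. *)
  + case: i hi => [|i] hi; first by rewrite [restrict _ _]EstarR0.
    by apply: sub_gen_smallest; right; left; exists i.+1.
  + by exists 0; rewrite // mul0mx base_col_Estar.
  + by exists 0; rewrite // mulmx0 base_row_Estar.
- apply: smallest_sub; first exact: corner_subalgebra.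
  move=> _ [->|[[i /andP[_ hi] <-]|->]].
  + exact: corner_Bmx.
  + exact: corner_EstarR.
  + exact: corner_bvec.
Qed.

Lemma Balg_sub_corner :
  (2 <= #|V|)%N -> Balg R adj a `<=` corner_algebra R adj a.
Proof.
move=> V2; apply: smallest_sub; first exact: corner_subalgebra.
have [S1 _ _ _] := corner_subalgebra.
move=> _ [[->|->]|->]; first exact: S1.
  exact: corner_Bmx.
by rewrite -EstarR1; apply/corner_EstarR/ecc_gt0.
Qed.

Lemma Balg_Emx : Balg R adj a (Emx R adj a).
Proof. by apply: sub_gen_smallest; right. Qed.

Lemma Balg_Bmx : Balg R adj a (Bmx R adj a).
Proof. by apply: sub_gen_smallest; left; right. Qed.

End CornerAlgebra.

(** * The weighted adjacency matrix of the vertex-deleted graph *)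

Section Residual.
Context {R : realType} {V : finType} (adj : rel V) (a : V).

Lemma sum_enum_val {W : finType} (F : W -> R) :
  \sum_(j : 'I_#|W|) F (enum_val j) = \sum_w F w.
Proof. by rewrite [RHS](reindex _ (onW_bij _ (@enum_val_bij W))). Qed.

Lemma Bmx_symmetric : symmetric adj -> (Bmx R adj a)^T = Bmx R adj a.
Proof. by move=> sym; apply/matrixP=> i j; rewrite !mxE /delete_vertex sym. Qed.

(** Deleting [a] lowers exactly the degrees of its neighbours, by one, and the
    diagonal matrix [E] restores them. *)
Lemma BE_row_sum (k : nat) (u : residual a) :
  symmetric adj -> #|adj (val u)| = k ->
  \sum_w (delete_vertex adj a u w)%:R + (adj a (val u))%:R = k%:R :> R.
Proof.
move=> sym <-; rewrite addrC sym -sum1_card natr_sum.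
rewrite -(sum_residual a (fun v => (adj (val u) v)%:R)) [RHS]big_mkcond /=.
by apply: eq_bigr => v _; rewrite unfold_in; case: (adj _ _).
Qed.

Lemma BE_mul (x : 'cV[R]_#|residual a|) (i : 'I_#|residual a|) :
  ((Bmx R adj a + Emx R adj a) *m x) i 0 =
  \sum_w (delete_vertex adj a (enum_val i) w)%:R * x (enum_rank w) 0 +
  (adj a (val (enum_val i)))%:R * x i 0.
Proof.
rewrite mulmxDl mul_diag_mx !mxE; congr (_ + _).
rewrite -(sum_enum_val (fun w => _ * x (enum_rank w) 0)).
by apply: eq_bigr => j _; rewrite mxE enum_valK.
Qed.

(** Regularity makes every row of [B + E] sum to [k], so the equation
    [(B + E) x = k x] says that [x] is harmonic on [G - a]. *)
Lemma bvec_Balg :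
  simple_graph adj -> regular_graph adj ->
  connected_graph (delete_vertex adj a) ->
  Balg R adj a (bvec R adj a *m (bvec R adj a)^T).
Proof.
move=> [sym _] [k kreg] econn.
have Balg_alg : unital_subalgebra (Balg R adj a) by apply: alg_gen_subalgebra.
have [_ BD _ BM] := Balg_alg.
have row_sum u := BE_row_sum k u sym (kreg (val u)).
have J : Balg R adj a (const_mx 1).
  apply: (ones_mem_subalgebra _ _ _ (Bmx R adj a + Emx R adj a) k%:R) => //.
  - by apply: BD; [apply: Balg_Bmx | apply: Balg_Emx].
  - by rewrite linearD /= Bmx_symmetric // tr_diag_mx.
  - apply/colP=> i; rewrite BE_mul !mxE !mulr1 -(row_sum (enum_val i)).
    by congr (_ + _); apply: eq_bigr => w _; rewrite mxE mulr1.
  - move=> x xk i j; rewrite -(enum_valK i) -(enum_valK j).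
    apply: (harmonic_constant (x := fun w => x (enum_rank w) 0) econn) => u.
    have := congr1 (fun y : 'cV__ => y (enum_rank u) 0) xk.
    rewrite BE_mul enum_rankK !mxE -(row_sum u) mulrDl => /addIr xu.
    rewrite -[RHS](subrr (\sum_w (delete_vertex adj a u w)%:R * x (enum_rank w) 0)).
    rewrite {1}xu mulr_suml -sumrB.
    by apply: eq_bigr => w _; rewrite mulrBr.
have -> : bvec R adj a *m (bvec R adj a)^T =
    Emx R adj a *m const_mx 1 *m Emx R adj a.
  apply/matrixP=> i j; rewrite mul_mx_diag mul_diag_mx !mxE big_ord1 !mxE.
  by rewrite mulr1.
by apply: (BM _ _ _ (Balg_Emx _ _)); apply: (BM _ _ (Balg_Emx _ _)).
Qed.

End Residual.

(** * Generators of the corner algebra *)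

Theorem lemma6p1 (R : realType) (V : finType) (adj : rel V) (a : V)
    (hsimple : simple_graph adj) (hconn : connected_graph adj)
    (hreg : regular_graph adj) (hcard : (2 <= #|V|)%N) :
  corner_algebra R adj a =
    alg_gen (Bmx R adj a |`
      ([set EstarR R adj a i | i in [set i | (1 <= i <= ecc adj a)%N]] `|`
       [set bvec R adj a *m (bvec R adj a)^T]))
  /\
  (connected_graph (delete_vertex adj a) ->
    [/\ Balg R adj a (bvec R adj a *m (bvec R adj a)^T),
        corner_algebra R adj a =
          alg_gen (Balg R adj a `|`
            [set EstarR R adj a i | i in [set i | (2 <= i <= ecc adj a)%N]]) &
        corner_algebra R adj a = Balg R adj a <->
          (forall i : nat, (1 <= i <= ecc adj a)%N ->
             Balg R adj a (EstarR R adj a i))]).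
Proof.
have [sym _] := hsimple.
have cornerE := @corner_algebra_gen R V adj a sym.
split=> // econn; have Bbb := @bvec_Balg R V adj a hsimple hreg econn.
split=> //.
- apply/seteqP; split.
  + rewrite cornerE; apply: smallest_sub; first exact: alg_gen_subalgebra.
    move=> _ [->|[[i /andP[i1 hi] <-]|->]].
    * by apply: sub_gen_smallest; left; apply: Balg_Bmx.
    * move: i1; rewrite leq_eqVlt => /orP[/eqP <-|i2].
        by apply: sub_gen_smallest; left; rewrite EstarR1; apply: Balg_Emx.
      by apply: sub_gen_smallest; right; exists i => //; apply/andP.
    * by apply: sub_gen_smallest; left.
  + apply: smallest_sub; first exact: corner_subalgebra.
    move=> M [|[i /andP[_ hi] <-]]; first exact: Balg_sub_corner.
    exact: corner_EstarR.
- split=> [<- i /andP[_ hi]|hE]; first exact: corner_EstarR.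
  apply/seteqP; split; last exact: Balg_sub_corner.
  rewrite cornerE; apply: smallest_sub; first exact: alg_gen_subalgebra.
  by move=> _ [->|[[i hi <-]|->]] //; [apply: Balg_Bmx | apply: hE].
Qed.
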